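(* Suppose that the oracle scores $S^1,\dots,S^K$ follow the $K$-class mixture model described in the context, and let $\alpha$ be a level chosen in advance. Let $D_\alpha$ be the collection of selection rules $\delta=(\delta^i)_{i\in D^{test}}\in\{0,1,\dots,K\}^{n^{test}}$ that satisfy $\mathrm{mFSR}\le\alpha$, and let $\mathrm{ETS}_\delta$ denote the ETS of a selection rule $\delta$. Let $\delta_{OR}$ be the oracle rule $$\delta^i_{OR}=\Big(\arg\max_{j\in\{1,\dots,K\}} S^j_i\Big)\cdot\mathbb I\{S_i>Q^{-1}(\alpha)\},\qquad i\in D^{test}.$$ Then $\delta_{OR}$ is optimal in the sense that $\mathrm{ETS}_{\delta_{OR}}\ge\mathrm{ETS}_\delta$ for every $\delta\in D_\alpha$.
   Context: Selective $K$-class classification. Samples are pairs $(X,Y)$ with feature vector $X\in\mathbb R^p$ and true class $Y\in\{1,\dots,K\}$; $D^{test}$ is a test set of size $n^{test}$ with unobserved labels. A selection rule $\delta$ assigns to each test sample, on the basis of the test features, a prediction $\hat Y_i=\delta^i\in\{0,1,\dots,K\}$, where $0$ means ''indecision''. Oracle scores: $S^j_i=P(Y_i=j\mid X_i)$, $j=1,\dots,K$, and $S_i=\max\{S^1_i,\dots,S^K_i\}$. Mixture model: $S^j\sim\pi_1F^j_1+\pi_2F^j_2+\dots+\pi_KF^j_K$ for $j=1,\dots,K$, where $\pi_k$ is the proportion of class $k$ and $F^j_k$ is the conditional CDF of the score $S^j$ given class $k$. For a selection rule with predictions $\hat Y_i$, $$\mathrm{mFSR}=\frac{\mathbb E\{\sum_{i\in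 D^{test}}\mathbb I(\hat Y_i\ne Y_i,\hat Y_i\neq 0)\}}{\mathbb E\{\sum_{i\in D^{test}}\mathbb I(\hat Y_i\ne 0)\}},\qquad \mathrm{ETS}=\mathbb E\Big\{\sum_{i\in D^{test}}\mathbb I(\hat Y_i=Y_i,\hat Y_i\ne0)\Big\}.$$ For a threshold $t$, $$Q(t)=\frac{\mathbb E\{\sum_{i\in D^{test}}(1-S_i)\mathbb I(S_i\ge t)\}}{\mathbb E\{\sum_{i\in D^{test}}\mathbb I(S_i\ge t)\}},$$ which is monotonically decreasing in $t$; $Q^{-1}(\alpha)$ denotes the corresponding threshold $t$ with $Q(t)=\alpha$ (taken to exist).
   Formalization: It is additionally assumed that no score S_i equals the threshold Q^{-1}(α) with positive probability (otherwise selecting on S_i ≥ Q^{-1}(α) has mFSR = α and larger ETS); the samples (X_i,Y_i) are taken to be mutually independent, and selection rules and argmax ties measurable. *)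

(* Defs.v *)
From HB Require Import structures.
From mathcomp Require Import all_boot all_order all_algebra.
From mathcomp Require Import all_classical all_reals all_analysis.

Set Implicit Arguments.
Unset Strict Implicit.
Unset Printing Implicit Defensive.

Import Order.TTheory GRing.Theory Num.Theory.
Local Open Scope classical_set_scope.
Local Open Scope ring_scope.

(* The classes 1, ..., K (K >= 1) are the elements of 'I_k.+1, with K = k.+1.
   A prediction in {0, 1, ..., K} is an element of option 'I_k.+1, where None
   is the value 0 (indecision).  Both types carry the discrete sigma-algebra. *)

HB.instance Definition _ (k : nat) := isPointed.Build 'I_k.+1 ord0.

HB.instance Definition _ (k : nat) :=
  @isMeasurable.Build default_measure_display 'I_k.+1 discrete_measurable
    discrete_measurable0 discrete_measurableC discrete_measurableU.

HB.instance Definition _ (k : nat) :=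
  @isMeasurable.Build default_measure_display (option 'I_k.+1)
    discrete_measurable discrete_measurable0 discrete_measurableC
    discrete_measurableU.

(* A feature vector in R^p and the family of the n test feature vectors; both
   tuple types carry the product sigma-algebra. *)
Notation feature R p := (p.-tuple (measurableTypeR R)).
Notation features R p n := (n.-tuple (feature R p)).

Section Selection.
Context (d : measure_display) (Omega : measurableType d) (R : realType)
        (P : probability Omega R) (n p k : nat).

Definition mutually_independent d' (E : measurableType d')
    (Z : 'I_n -> Omega -> E) : Prop :=
  forall (J : {set 'I_n}) (B : 'I_n -> set E),
    (forall i, measurable (B i)) ->
    P (\bigcap_(i in [set` J]) (Z i @^-1` B i)) =
    (\prod_(i in J) P (Z i @^-1` B i))%E.

(* eta j is a version of x |-> P(Y = j | X = x): the random variable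
   eta j \o X is sigma(X)-measurable because eta j is measurable.  Its
   integrability follows from the displayed identity. *)
Definition is_cond_prob (X : {RV P >-> feature R p})
    (Y : {RV P >-> 'I_k.+1})
    (eta : 'I_k.+1 -> {mfun feature R p >-> measurableTypeR R}) : Prop :=
  forall (j : 'I_k.+1) (A : set (feature R p)), measurable A ->
    (\int[P]_(w in X @^-1` A) (eta j (X w))%:E =
     P (X @^-1` A `&` Y @^-1` [set j]))%E.

(* [score j w] is S^j; [pi c] is the proportion of class c; [F j c] is the
   conditional CDF of S^j given class c, specified without division by pi c
   (so that it is unconstrained when class c has probability 0). *)
Definition mixture_model (score : 'I_k.+1 -> Omega -> R)
    (Y : {RV P >-> 'I_k.+1}) (pi : 'I_k.+1 -> R)
    (F : 'I_k.+1 -> 'I_k.+1 -> R -> R) : Prop :=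
  [/\ forall c, P (Y @^-1` [set c]) = (pi c)%:E,
      forall j c x, P ([set w | score j w <= x] `&` Y @^-1` [set c]) =
                    (pi c * F j c x)%:E &
      forall j x, P [set w | score j w <= x] =
                  (\sum_(c < k.+1) pi c * F j c x)%:E].

(* The default value of the maximum is one of the scores, so this is the exact
   maximum over the nonempty set of classes, whatever the sign of the scores. *)
Definition max_score (s : 'I_k.+1 -> R) : R :=
  \big[Num.max/s ord0]_(j < k.+1) s j.

(* Division by 0 yields 0, so a procedure that almost surely never selects has
   mFSR 0. *)
Definition mFSR (Y : 'I_n -> Omega -> 'I_k.+1)
    (Yhat : 'I_n -> Omega -> option 'I_k.+1) : R :=
  fine 'E_P[fun w => \sum_(i < n)
              ((Yhat i w != Some (Y i w)) && (Yhat i w != None))%:R : R] /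
  fine 'E_P[fun w => \sum_(i < n) (Yhat i w != None)%:R : R].

Definition ETS (Y : 'I_n -> Omega -> 'I_k.+1)
    (Yhat : 'I_n -> Omega -> option 'I_k.+1) : R :=
  fine 'E_P[fun w => \sum_(i < n)
              ((Yhat i w == Some (Y i w)) && (Yhat i w != None))%:R : R].

(* Here and below, S i is the maximal oracle score of test sample i. *)
Definition expected_selected (S : 'I_n -> Omega -> R) (t : R) : R :=
  fine 'E_P[fun w => \sum_(i < n) (t <= S i w)%R%:R : R].

Definition Q (S : 'I_n -> Omega -> R) (t : R) : R :=
  fine 'E_P[fun w => \sum_(i < n) (1 - S i w) * (t <= S i w)%R%:R : R] /
  expected_selected S t.

(* The positive denominator excludes thresholds at which Q is undefined. *)
Definition is_Q_inverse (S : 'I_n -> Omega -> R) (alpha t : R) : Prop :=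
  0 < expected_selected S t /\ Q S t = alpha.

(* The predictions of a selection rule: delta i maps the features of the whole
   test set to the prediction for test sample i. *)
Definition predictions (X : 'I_n -> Omega -> feature R p)
    (delta : 'I_n -> features R p n -> option 'I_k.+1) (i : 'I_n) (w : Omega)
    : option 'I_k.+1 :=
  delta i [tuple X l w | l < n].

Definition in_D_alpha (X : 'I_n -> Omega -> feature R p)
    (Y : 'I_n -> Omega -> 'I_k.+1) (alpha : R)
    (delta : 'I_n -> features R p n -> option 'I_k.+1) : Prop :=
  (forall i, measurable_fun setT (delta i)) /\
  mFSR Y (predictions X delta) <= alpha.

(* amax i x is an element of arg max_j eta i j x; ties may be broken in any
   measurable way. *)
Definition is_argmax (eta : 'I_n -> 'I_k.+1 -> feature R p -> R)
    (amax : 'I_n -> feature R p -> 'I_k.+1) : Prop :=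
  (forall i, measurable_fun setT (amax i)) /\
  (forall i x j, eta i j x <= eta i (amax i x) x).

(* The rule selects on the strict inequality t < S i, while Q is defined with
   t <= S i; the two agree almost surely when S i has no atom at t. *)
Definition oracle_rule (eta : 'I_n -> 'I_k.+1 -> feature R p -> R)
    (amax : 'I_n -> feature R p -> 'I_k.+1) (t : R)
    (i : 'I_n) (x : features R p n) : option 'I_k.+1 :=
  if t < max_score (fun j => eta i j (tnth x i))
  then Some (amax i (tnth x i)) else None.

End Selection.

(* Main.v *)
Require Import Defs.
From mathcomp Require Import all_boot all_order all_algebra.
From mathcomp Require Import all_classical all_reals all_analysis.
From mathcomp Require Import measurable_realfun lra.

(* A prediction of class j for a sample is correct with conditional probability
   S^j given all the test features, by independence of the samples; so ETS is
   the expected sum of the scores S^j of the predictions made, and mFSR <= alpha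
   says that the expected sum of S^j - (1 - alpha) over the selected samples is
   nonnegative.  The oracle rule meets this constraint with equality.  For
   0 <= t, adding the constraint with the Lagrange multiplier
   t / (1 - alpha - t) to ETS gives a functional proportional to the expected
   sum of S^j - t over the selected samples, which the oracle rule maximizes
   pointwise.  For t < 0 the oracle rule selects every sample almost surely and
   maximizes ETS pointwise without the constraint. *)

Set Implicit Arguments.
Unset Strict Implicit.
Unset Printing Implicit Defensive.

Import Order.TTheory GRing.Theory Num.Theory.
Local Open Scope classical_set_scope.
Local Open Scope ring_scope.

(** * Measurable rectangles as a generating pi-system of the product sigma-algebra *)

Lemma measurable_preimage d d' (T1 : measurableType d) (T2 : measurableType d')
    (f : T1 -> T2) (A : set T2) :
  measurable_fun setT f -> measurable A -> measurable (f @^-1` A).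
Proof. by move=> mf mA; rewrite -[_ @^-1` _]setTI; exact: mf. Qed.

Definition rectangles d (T : measurableType d) n : set_system (n.-tuple T) :=
  [set A | exists2 B : 'I_n -> set T, forall l, measurable (B l) &
     A = \bigcap_(l in [set: 'I_n]) ((@tnth n T)^~ l @^-1` B l)].

Lemma rectangle_measurable d (T : measurableType d) n (A : set (n.-tuple T)) :
  rectangles A -> measurable A.
Proof.
move=> [B mB ->]; apply: fin_bigcap_measurable => // l _.
by apply: measurable_preimage => //; exact: measurable_tnth.
Qed.

(** A generator of the product sigma-algebra constrains a single coordinate, so it is a rectangle
    whose other sides are [setT]; conversely a rectangle is a finite intersection of such
    cylinders. *)
Lemma measurable_tupleE d (T : measurableType d) n :
  @measurable _ (n.-tuple T) = <<s @rectangles _ T n >>.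
Proof.
apply/seteqP; split; last first.
  apply: smallest_sub; first exact: sigma_algebra_measurable.
  exact: rectangle_measurable.
apply: smallest_sub; first exact: smallest_sigma_algebra.
move=> A; rewrite -bigcup_seq => -[i _ [B mB <-]]; rewrite setTI.
apply: sub_sigma_algebra; exists (fun l => if l == i then B else setT).
  by move=> l; case: ifP.
apply/seteqP; split => [x /= Bx l _ /=|x /= /(_ i Logic.I)]; last by rewrite eqxx.
by case: eqP => [->|].
Qed.

Lemma setI_closed_rectangles d (T : measurableType d) n :
  setI_closed (@rectangles _ T n).
Proof.
move=> _ _ [A mA ->] [B mB ->]; exists (fun l => A l `&` B l).
  by move=> l; exact: measurableI.
by rewrite -bigcapI.
Qed.

(** * Integration over an event independent of a random variable *)

Section restriction.
Context d (T : measurableType d) (R : realType).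
Variables (mu : {measure set T -> \bar R}) (C : set T) (mC : measurable C).
Local Open Scope ereal_scope.

(** The complement of [C] is null for the restricted measure, and on measurable subsets of [C] the
    two measures coincide. *)
Lemma ge0_integral_mrestr (E : set T) (f : T -> \bar R) : measurable E ->
  measurable_fun E f -> (forall x, E x -> 0 <= f x) ->
  \int[mrestr mu mC]_(x in E) f x = \int[mu]_(x in E `&` C) f x.
Proof.
move=> mE mf f0.
rewrite (@ge0_negligible_integral _ _ _ _ E (~` C))//; last 2 first.
- exact: measurableC.
- by rewrite /= /mrestr setICl measure0.
rewrite setDE setCK; apply: eq_measure_integral => A mA AEC.
by rewrite /= /mrestr setIidl// => x /AEC[].
Qed.

End restriction.

Section independent_integral.
Context d d' (T : measurableType d) (E : measurableType d') (R : realType)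
        (P : probability T R).
Local Open Scope ereal_scope.

(** Both integrals become integrals of [h] over [B] by pushing forward along [Z], one from [P]
    restricted to [C] and one from [P]. Independence says that the first image measure is [P C]
    times the second. *)
Lemma ge0_integral_independent (C : set T) (Z : T -> E) (h : E -> \bar R)
    (B : set E) :
  measurable C -> measurable_fun setT Z -> measurable_fun setT h ->
  (forall x, 0 <= h x) -> measurable B ->
  (forall B, measurable B -> P (C `&` Z @^-1` B) = P C * P (Z @^-1` B)) ->
  \int[P]_(w in C `&` Z @^-1` B) h (Z w) = P C * \int[P]_(w in Z @^-1` B) h (Z w).
Proof.
move=> mC mZ mh h0 mB CZ.
have mhB : measurable_fun B h by exact: measurable_funTS.
have mZB : measurable (Z @^-1` B) by exact: measurable_preimage.
have PCr : P C = (fine (P C))%:E by rewrite fineK// fin_num_measure.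
have PC0 : (0 <= fine (P C))%R by rewrite fine_ge0.
rewrite setIC -(ge0_integral_mrestr P mC)//; last first.
  by apply: measurable_funTS; exact: measurableT_comp.
rewrite -(@ge0_integral_pushforward _ _ _ _ _ _ mZ (mrestr P mC) B h)//.
rewrite -(@ge0_integral_pushforward _ _ _ _ _ _ mZ P B h)//.
rewrite [in RHS]PCr -(@ge0_integral_mscale _ _ _ _ _ mB (NngNum PC0))//.
apply: eq_measure_integral => A mA _.
by rewrite /= /pushforward /mrestr /mscale/= -PCr setIC CZ.
Qed.

End independent_integral.

(** * Real-valued integrals of indicators and finite sums, and almost sure consequences of integral
    identities *)

Section real_integral.
Context d (T : measurableType d) (R : realType) (P : probability T R).
Implicit Types (f g : T -> R) (b : T -> bool).

Lemma nat_of_bool_indic b : (fun w => (b w)%:R : R) = \1_[set w | b w].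
Proof.
apply/funext => w; rewrite indicE; congr ((nat_of_bool _)%:R).
by apply/idP/idP; rewrite inE.
Qed.

Lemma measurable_indic_bool b :
  measurable [set w | b w] -> measurable_fun setT (fun w => (b w)%:R : R).
Proof. by move=> mb; rewrite nat_of_bool_indic; exact: measurable_indic. Qed.

Lemma integrable_indic_bool b : measurable [set w | b w] ->
  P.-integrable setT (EFin \o (fun w => (b w)%:R : R)).
Proof. by move=> mb; rewrite nat_of_bool_indic; exact: integrable_indic. Qed.

Lemma Rintegral_indic_bool b : measurable [set w | b w] ->
  \int[P]_w (b w)%:R = fine (P [set w | b w]).
Proof.
move=> mb; rewrite /Rintegral; congr fine.
have -> : (fun w => ((b w)%:R : R)%:E) = EFin \o \1_[set w | b w].
  by rewrite -nat_of_bool_indic.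
by rewrite integral_indic// setIT.
Qed.

Lemma integrable_boolM b f : measurable [set w | b w] ->
  P.-integrable setT (EFin \o f) ->
  P.-integrable setT (EFin \o (fun w => (b w)%:R * f w)).
Proof.
move=> mb fi; have mf : measurable_fun setT f.
  exact/measurable_EFinP/(measurable_int P).
apply: le_integrable fi => //.
  apply/measurable_EFinP; apply: measurable_funM => //.
  exact: measurable_indic_bool.
move=> w _ /=; rewrite lee_fin; case: (b w); rewrite ?mul1r// mul0r normr0.
by rewrite normr_ge0.
Qed.

Lemma Rintegral_boolM b f : measurable [set w | b w] ->
  \int[P]_w ((b w)%:R * f w) = \int[P]_(w in [set w | b w]) f w.
Proof.
move=> mb; rewrite [RHS]Rintegral_mkcond; apply: eq_Rintegral => w _.
rewrite patchE; case: ifPn => [|].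
  by rewrite inE /= => ->; rewrite mul1r.
by rewrite notin_setE /= => /negP /negbTE ->; rewrite mul0r.
Qed.

Lemma integrable_sumR (I : finType) (F : I -> T -> R) :
  (forall i, P.-integrable setT (EFin \o F i)) ->
  P.-integrable setT (EFin \o (fun w => \sum_i F i w)).
Proof.
move=> Fi; rewrite (_ : _ \o _ = fun w => (\sum_i (F i w)%:E)%E).
  by apply: integrable_sum => // i _; exact: Fi.
by apply/funext => w /=; rewrite sumEFin.
Qed.

Lemma Rintegral_sum (I : finType) (F : I -> T -> R) :
  (forall i, P.-integrable setT (EFin \o F i)) ->
  \int[P]_w (\sum_i F i w) = \sum_i \int[P]_w F i w.
Proof.
move=> Fi; apply: EFin_inj; rewrite -sumEFin /Rintegral fineK.
  under eq_integral do rewrite -sumEFin.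
  rewrite integral_sum//; apply: eq_bigr => i _; rewrite fineK//.
  exact: integrable_fin_num (Fi i).
exact: integrable_fin_num (integrable_sumR Fi).
Qed.

Lemma ae_eq_Rintegral f g : measurable_fun setT f -> measurable_fun setT g ->
  {ae P, forall w, f w = g w} -> \int[P]_w f w = \int[P]_w g w.
Proof.
move=> mf mg fg; rewrite /Rintegral; congr fine.
apply: ae_eq_integral => //; [exact/measurable_EFinP|exact/measurable_EFinP|].
by apply: filterS fg => w /= ->.
Qed.

Lemma Rintegral_eq0_ae f : P.-integrable setT (EFin \o f) ->
  (forall w, 0 <= f w) -> \int[P]_w f w = 0 -> {ae P, forall w, f w = 0}.
Proof.
move=> fi f0 If.
have : ae_eq P setT (EFin \o f) (cst 0%E).
  apply/ae_eq_integral_abs => //; first exact: measurable_int fi.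
  under eq_integral => w _ do rewrite /= ger0_norm//.
  rewrite -[LHS]fineK; first by move: If; rewrite /Rintegral => ->.
  exact: integrable_fin_num fi.
by apply: filterS => w /(_ Logic.I) [].
Qed.

(** On the set where [f] is negative its integral is also at most 0, so the integral of the absolute
    value vanishes there. Hence [f] is almost everywhere 0 on a set where it is negative, and this
    set is null. *)
Lemma integral_neg_ge0_ae f : measurable_fun setT f ->
  (0 <= \int[P]_(w in [set w | (f w < 0)%R]) (f w)%:E)%E ->
  {ae P, forall w, 0 <= f w}.
Proof.
move=> mf; set N := [set w | f w < 0].
have mN : measurable N.
  rewrite (_ : N = f @^-1` `]-oo, 0[%classic); last first.
    by apply/seteqP; split => w /=; rewrite in_itv.
  exact: measurable_preimage.
have mfN : measurable_fun N (EFin \o f).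
  by apply/measurable_EFinP; exact: measurable_funTS.
move=> intN.
have : ae_eq P N (EFin \o f) (cst 0%E).
  apply/ae_eq_integral_abs => //; apply/eqP; rewrite eq_le; apply/andP; split.
    rewrite -oppe_ge0 -integral_ge0N// (le_trans intN)// le_eqVlt; apply/orP.
    left; apply/eqP/eq_integral => w; rewrite inE /N /= => w0.
    by rewrite ltr0_norm// opprK.
  by apply: integral_ge0 => w _; exact: abse_ge0.
apply: filterS => w /= fN; rewrite leNgt; apply/negP => w0.
by have [] := fN w0; move/eqP; rewrite lt_eqF.
Qed.

End real_integral.

(** * Conditioning on the features of the whole test set *)

Section sampling.
Context d (Omega : measurableType d) (R : realType) (P : probability Omega R)
        (n p k : nat).
Local Open Scope ereal_scope.

(** Mutual independence is used twice, for all indices and for all indices but [i], with the side at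
    [i] replaced by [A]; the two products differ by the factor at [i]. *)
Lemma independent_others d' (E : measurableType d') (Z : 'I_n -> Omega -> E)
    (i : 'I_n) (B : 'I_n -> set E) (A : set E) :
  mutually_independent P Z -> (forall l, measurable (B l)) -> measurable A ->
  P (\bigcap_(l in [set` [set~ i]%SET]) (Z l @^-1` B l) `&` Z i @^-1` A) =
  P (\bigcap_(l in [set` [set~ i]%SET]) (Z l @^-1` B l)) * P (Z i @^-1` A).
Proof.
move=> indep mB mA.
pose B' l := if l == i then A else B l.
have mB' l : measurable (B' l) by rewrite /B'; case: ifP.
have capE : \bigcap_(l in [set` [set~ i]%SET]) (Z l @^-1` B l) =
            \bigcap_(l in [set` [set~ i]%SET]) (Z l @^-1` B' l).
  by apply: eq_bigcapr => l /=; rewrite !inE /B' => /negbTE ->.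
have -> : \bigcap_(l in [set` [set~ i]%SET]) (Z l @^-1` B l) `&` Z i @^-1` A =
          \bigcap_(l in [set` [set: 'I_n]%SET]) (Z l @^-1` B' l).
  rewrite capE; apply/seteqP; split=> [w [wB wA] l _|w wB].
    have [->|li] := eqVneq l i; first by rewrite /B'/= eqxx.
    by apply: wB; rewrite /= !inE.
  split; first by move=> l _; apply: wB; rewrite /= inE.
  by have := wB i; rewrite /B' /= inE eqxx; exact.
rewrite capE !indep// (bigD1 i) ?inE//= muleC.
congr (_ * _); last by rewrite /B' eqxx.
by apply: eq_bigl => l; rewrite !inE.
Qed.

Lemma measurable_tuple_of (X : 'I_n -> {RV P >-> feature R p}) :
  measurable_fun setT (fun w => [tuple X l w | l < n]).
Proof.
apply/measurable_fun_tnthP => i.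
rewrite (_ : _ \o _ = X i :> (_ -> _)); first exact: measurable_funP.
by apply/funext => w /=; rewrite tnth_mktuple.
Qed.

(* Conditionally on [X i], the class of sample [i] does not depend on the
   features of the other samples: a version of P(Y_i = j | X_i) is a version of
   the conditional probability given the features of the whole test set. *)
Lemma cond_prob_all_features (X : 'I_n -> {RV P >-> feature R p})
    (Y : 'I_n -> {RV P >-> 'I_k.+1}) (i : 'I_n) (j : 'I_k.+1)
    (h : feature R p -> R) :
  mutually_independent P (fun i w => (X i w, Y i w)) ->
  measurable_fun setT h -> (forall x, 0 <= h x)%R ->
  (forall B, measurable B -> \int[P]_(w in X i @^-1` B) (h (X i w))%:E =
    P (X i @^-1` B `&` Y i @^-1` [set j])) ->
  forall A : set (features R p n), measurable A ->
  \int[P]_(w in (fun w => [tuple X l w | l < n]) @^-1` A) (h (X i w))%:E =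
  P ((fun w => [tuple X l w | l < n]) @^-1` A `&` Y i @^-1` [set j]).
Proof.
move=> indep mh h0 hE; set T := (fun w => [tuple X l w | l < n]).
have mT : measurable_fun setT T by exact: measurable_tuple_of.
have mX : measurable_fun setT (X i) by exact: measurable_funP.
have mhE : measurable_fun setT (fun x => (h x)%:E) by exact/measurable_EFinP.
have mhX : measurable_fun setT (fun w => (h (X i w))%:E).
  exact: (measurableT_comp mhE).
have mY : measurable (Y i @^-1` [set j]).
  by apply: measurable_preimage => //; exact: measurable_funP.
have intT : \int[P]_w (h (X i w))%:E = P (Y i @^-1` [set j]).
  by have := hE _ measurableT; rewrite preimage_setT setTI.
(* As functions of [A], both sides are finite measures of the same total mass, the probability of
   class [j]; by the pi-lambda theorem it is enough to compare them on rectangles. *)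
rewrite measurable_tupleE; apply: dynkin_induction.
- exact: measurable_tupleE.
- exact: setI_closed_rectangles.
- by rewrite preimage_setT setTI.
- move=> _ [B mB ->].
  (* [C] collects the conditions on the other samples. It is independent of the pair [(X i, Y i)],
     so [P C] factors out of both sides and the given identity for [X i] alone remains. *)
  pose C := \bigcap_(l in [set` [set~ i]%SET]) (X l @^-1` B l).
  have TE : T @^-1` (\bigcap_(l in [set: 'I_n]) ((@tnth n _)^~ l @^-1` B l)) =
            C `&` X i @^-1` B i.
    apply/seteqP; split=> [w wB|w [wC wi] l _ /=].
      split; first by move=> l _; have := wB l Logic.I; rewrite /= tnth_mktuple.
      by have := wB i Logic.I; rewrite /= tnth_mktuple.
    rewrite tnth_mktuple; have [->//|li] := eqVneq l i.
    by apply: wC; rewrite /= !inE.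
  have mC : measurable C.
    apply: fin_bigcap_measurable => // l _; exact: measurable_preimage.
  have CZ (A : set (feature R p * 'I_k.+1)) : measurable A ->
      P (C `&` (fun w => (X i w, Y i w)) @^-1` A) =
      P C * P ((fun w => (X i w, Y i w)) @^-1` A).
    (* Independence is assumed for feature-class pairs, so a condition on features alone is written
       with the whole class set as second side. *)
    move=> mA; have mB' m : measurable (B m `*` [set: 'I_k.+1]).
      exact: measurableX.
    have := independent_others i indep mB' mA.
    rewrite [X in P (X `&` _)](_ : _ = C); last first.
      by apply: eq_bigcapr => l _; apply/seteqP; split => [w []|].
    rewrite [X in _ = P X * _](_ : _ = C)//.
    by apply: eq_bigcapr => l _; apply/seteqP; split => [w []|].
  rewrite TE (@ge0_integral_independent _ _ _ _ _ P C (X i)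
    (fun x => (h x)%:E))//; last first.
    move=> B' mB'; have := CZ (B' `*` setT) (measurableX mB' measurableT).
    by rewrite (_ : _ @^-1` (B' `*` setT) = X i @^-1` B')//;
      apply/seteqP; split => [w []|].
  rewrite hE// -setIA; symmetry.
  exact: (CZ (B i `*` [set j]) (measurableX (mB i) (Logic.I : measurable [set j]))).
(* For a complement, both sides are the total mass minus the value at [S]; the subtraction is
   legitimate because that value is finite. *)
- move=> S mS IH; rewrite preimage_setC.
  have mTS : measurable (T @^-1` S) by exact: measurable_preimage.
  have mCS : measurable (~` (T @^-1` S)) by exact: measurableC.
  have : P (Y i @^-1` [set j]) =
     \int[P]_(w in T @^-1` S) (h (X i w))%:E +
     \int[P]_(w in ~` (T @^-1` S)) (h (X i w))%:E.
    rewrite -ge0_integral_setU//; first by rewrite setUCr intT.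
    + exact: measurable_funTS.
    + by move=> w _; rewrite lee_fin.
    + by rewrite disj_set2E setICr.
  have -> : P (Y i @^-1` [set j]) = P (T @^-1` S `&` Y i @^-1` [set j]) +
      P (~` (T @^-1` S) `&` Y i @^-1` [set j]).
    rewrite -measureU//; first by rewrite -setIUl setUCr setTI.
    + exact: measurableI.
    + exact: measurableI.
    + by rewrite setIACA setICr set0I.
  rewrite IH => H; rewrite -[LHS](@addeK _ (P (T @^-1` S `&` Y i @^-1` [set j]))).
    by rewrite [X in X - _]addeC -H addeAC subee ?add0e// fin_num_measure//;
      exact: measurableI.
  by rewrite fin_num_measure//; exact: measurableI.
- move=> F mF tF IH.
  have tTF : trivIset setT (fun m => T @^-1` F m).
    apply/trivIsetP => a b _ _ ab; rewrite -preimage_setI.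
    by move/trivIsetP : tF => /(_ _ _ _ _ ab) ->//; rewrite preimage_set0.
  have mTF m : measurable (T @^-1` F m) by exact: measurable_preimage.
  rewrite preimage_bigcup setI_bigcupl ge0_integral_bigcup//; last 2 first.
  + exact: measurable_funTS.
  + by move=> w _; rewrite lee_fin.
  rewrite measure_bigcup//; last 2 first.
  + by move=> m _; exact: measurableI.
  + apply/trivIsetP => a b _ _ ab; rewrite setIACA.
    by move/trivIsetP : tTF => /(_ _ _ _ _ ab) ->//; rewrite set0I.
  rewrite [RHS](@eq_eseriesl _ _ xpredT); last by move=> m; rewrite in_setT.
  by apply: eq_eseriesr => m _; rewrite IH.
Qed.

End sampling.

Lemma fine_expectation d (T : measurableType d) (R : realType)
  (P : probability T R) (f : T -> R) : fine 'E_P[f] = \int[P]_w f w.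
Proof. by rewrite unlock. Qed.

(** * Almost sure sign and integrability of the scores *)

Section cond_prob.
Context d (Omega : measurableType d) (R : realType) (P : probability Omega R)
        (p k : nat) (X : {RV P >-> feature R p}) (Y : {RV P >-> 'I_k.+1})
        (eta : 'I_k.+1 -> {mfun feature R p >-> measurableTypeR R}).
Hypothesis etaP : is_cond_prob X Y eta.

Lemma measurable_score j : measurable_fun setT (fun w => eta j (X w) : R).
Proof. exact: (measurableT_comp (measurable_funP (eta j)) (measurable_funP X)). Qed.

(** The integral of the score over the event that it is negative is a probability, hence
    nonnegative. *)
Lemma cond_prob_ge0 j : {ae P, forall w, 0 <= (eta j (X w) : R)}.
Proof.
apply: integral_neg_ge0_ae; first exact: measurable_score.
have mN : measurable [set x | (eta j x : R) < 0].
  rewrite (_ : [set _ | _] = eta j @^-1` `]-oo, 0[%classic); last first.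
    by apply/seteqP; split => x /=; rewrite in_itv.
  by apply: measurable_preimage => //; exact: measurable_funP.
apply: le_trans (measure_ge0 P _) _.
rewrite le_eqVlt; apply/orP; left; apply/eqP; exact/esym/(etaP j mN).
Qed.

(** A version of the conditional probability may be negative on a null set; its positive part is a
    version that is nonnegative everywhere, as [cond_prob_all_features] requires. *)
Lemma cond_prob_nonneg_part j (B : set (feature R p)) : measurable B ->
  (\int[P]_(w in X @^-1` B) (Num.max (eta j (X w) : R) 0)%:E =
   P (X @^-1` B `&` Y @^-1` [set j]))%E.
Proof.
move=> mB; rewrite -etaP//.
have mXB : measurable (X @^-1` B).
  by apply: measurable_preimage => //; exact: measurable_funP.
apply: ae_eq_integral => //.
- apply/measurable_EFinP/measurable_funTS/measurable_maxr => //.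
  exact: measurable_score.
- exact/measurable_EFinP/measurable_funTS/measurable_score.
- by apply: filterS (cond_prob_ge0 j) => w w0 _; rewrite max_l.
Qed.

(** The absolute value of the score agrees almost surely with its positive part, whose integral is
    the probability of class [j]. *)
Lemma integrable_score j :
  P.-integrable setT (EFin \o (fun w => eta j (X w) : R)).
Proof.
apply/integrableP; split; first exact/measurable_EFinP/measurable_score.
rewrite (@ae_eq_integral _ _ _ P setT
  (fun w => (Num.max (eta j (X w) : R) 0)%:E)) //.
- have := cond_prob_nonneg_part j measurableT; rewrite preimage_setT => ->.
  by rewrite setTI ltey_eq fin_num_measure//; apply: measurable_preimage => //;
    exact: measurable_funP.
- by apply/measurable_EFinP; apply: measurableT_comp => //; exact: measurable_score.
- by apply/measurable_EFinP/measurable_maxr => //; exact: measurable_score.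
- by apply: filterS (cond_prob_ge0 j) => w w0 _; rewrite /= max_l// ger0_norm.
Qed.

End cond_prob.

(** * ETS and mFSR of a rule in terms of the scores *)

Section test_sample.
Context d (Omega : measurableType d) (R : realType) (P : probability Omega R)
        (n p k : nat) (X : 'I_n -> {RV P >-> feature R p})
        (Y : 'I_n -> {RV P >-> 'I_k.+1})
        (eta : 'I_n -> 'I_k.+1 -> {mfun feature R p >-> measurableTypeR R}).
Hypothesis indep : mutually_independent P (fun i w => (X i w, Y i w)).
Hypothesis etaP : forall i, is_cond_prob (X i) (Y i) (eta i).
Local Notation T := (fun w => [tuple X l w | l < n]).

Lemma Rintegral_score_test i j (A : set (features R p n)) : measurable A ->
  \int[P]_(w in T @^-1` A) (eta i j (X i w) : R) =
  fine (P (T @^-1` A `&` Y i @^-1` [set j])).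
Proof.
move=> mA; have ms := measurable_score (X i) (eta i) j.
have mTA : measurable (T @^-1` A).
  by apply: measurable_preimage => //; exact: measurable_tuple_of.
rewrite -(@cond_prob_all_features _ _ _ _ _ _ _ X Y i j
  (fun x => Num.max (eta i j x : R) 0))//.
- rewrite /Rintegral; congr fine; apply: ae_eq_integral => //.
  + exact/measurable_EFinP/measurable_funTS.
  + exact/measurable_EFinP/measurable_funTS/measurable_maxr.
  + by apply: filterS (cond_prob_ge0 (etaP i) j) => w w0 _; rewrite max_l.
- by apply: measurable_maxr => //; exact: (measurable_funP (eta i j)).
- by move=> x; rewrite le_max lexx orbT.
- by move=> B mB; apply: cond_prob_nonneg_part.
Qed.

Section rule.
Variable delta : 'I_n -> features R p n -> option 'I_k.+1.
Hypothesis mdelta : forall i j, measurable (delta i @^-1` [set Some j]).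

(** The conditional probability, given all test features, that sample [i] is selected and correctly
    classified. *)
Definition gain i w : R :=
  \sum_j (predictions X delta i w == Some j)%:R * (eta i j (X i w) : R).

Definition selected i w : R := (predictions X delta i w != None)%:R.

Lemma measurable_prediction i j :
  measurable [set w | predictions X delta i w == Some j].
Proof.
rewrite (_ : [set _ | _] = T @^-1` (delta i @^-1` [set Some j])).
  by apply: measurable_preimage => //; exact: measurable_tuple_of.
by apply/seteqP; split => w /= /eqP.
Qed.

Lemma measurable_selected i : measurable [set w | predictions X delta i w != None].
Proof.
rewrite (_ : [set _ | _] =
    \big[setU/set0]_(j < k.+1) [set w | predictions X delta i w == Some j]).
  by apply: bigsetU_measurable => j _; exact: measurable_prediction.
rewrite -bigcup_seq; apply/seteqP; split => [w /=|w [j _ /=] /eqP ->//].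
case E : (predictions X delta i w) => [j|//] _; exists j => /=.
  by rewrite mem_index_enum.
by rewrite E.
Qed.

Lemma measurable_correct i j : measurable
  [set w | (predictions X delta i w == Some j) && (Y i w == j)].
Proof.
rewrite (_ : [set _ | _] = [set w | predictions X delta i w == Some j] `&`
                           Y i @^-1` [set j]).
  apply: measurableI; first exact: measurable_prediction.
  by apply: measurable_preimage => //; exact: measurable_funP.
by apply/seteqP; split => [w /= /andP[-> /eqP ->]|w [/= -> ->]]; rewrite ?eqxx.
Qed.

(** Conditional probabilities are given one class at a time, so correctness is split according to
    the predicted class. *)
Let correctE i w : ((predictions X delta i w == Some (Y i w)) &&
    (predictions X delta i w != None))%:R =
  \sum_j ((predictions X delta i w == Some j) && (Y i w == j))%:R :> R.
Proof.
rewrite (bigD1 (Y i w))//= big1 ?addr0; last first.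
  by move=> j /negbTE jY; rewrite [Y i w == j]eq_sym jY andbF.
by rewrite eqxx andbT; case: (predictions X delta i w) => [j|//]; rewrite andbT.
Qed.

Lemma integrable_correct i : P.-integrable setT (EFin \o (fun w =>
  ((predictions X delta i w == Some (Y i w)) &&
   (predictions X delta i w != None))%:R : R)).
Proof.
rewrite (funext (correctE i)).
apply: integrable_sumR => j; apply: integrable_indic_bool.
exact: measurable_correct.
Qed.

Lemma integrable_gain i : P.-integrable setT (EFin \o gain i).
Proof.
apply: integrable_sumR => j; apply: integrable_boolM.
  exact: measurable_prediction.
exact: integrable_score.
Qed.

Lemma integrable_selected i : P.-integrable setT (EFin \o selected i).
Proof. by apply: integrable_indic_bool; exact: measurable_selected. Qed.

(* Replacing the unobserved event [Yhat i = Y i] by its conditional probability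
   given the features of the whole test set. *)
Lemma ETS_gain :
  ETS P Y (predictions X delta) = \int[P]_w (\sum_i gain i w).
Proof.
rewrite /ETS fine_expectation [LHS]Rintegral_sum; last first.
  exact: integrable_correct.
rewrite [RHS]Rintegral_sum; last exact: integrable_gain.
apply: eq_bigr => i _; under eq_Rintegral do rewrite correctE.
rewrite [LHS]Rintegral_sum; last first.
  by move=> j; apply: integrable_indic_bool; exact: measurable_correct.
rewrite [RHS]Rintegral_sum; last first.
  move=> j; apply: integrable_boolM; first exact: measurable_prediction.
  exact: integrable_score.
apply: eq_bigr => j _.
rewrite Rintegral_indic_bool; last exact: measurable_correct.
rewrite Rintegral_boolM; last exact: measurable_prediction.
have -> : [set w | predictions X delta i w == Some j] =
          T @^-1` (delta i @^-1` [set Some j]).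
  by apply/seteqP; split => w /= /eqP.
rewrite Rintegral_score_test//; congr (fine (P _)).
apply/seteqP; split => [w /andP[/eqP pE /eqP YE]|w [pE YE]]; first by split.
by apply/andP; split; exact/eqP.
Qed.

Lemma ETS_ge0 : 0 <= ETS P Y (predictions X delta).
Proof. by rewrite /ETS fine_expectation Rintegral_ge0// => w _; rewrite sumr_ge0. Qed.

(** A selected sample is either correct or false, so the numerator of mFSR is the expected number of
    selections minus ETS; it remains to clear the denominator. *)
Lemma mFSR_le_ETS alpha : mFSR P Y (predictions X delta) <= alpha ->
  (1 - alpha) * \int[P]_w (\sum_i selected i w) <= ETS P Y (predictions X delta).
Proof.
have numE : \int[P]_w (\sum_i ((predictions X delta i w != Some (Y i w)) &&
      (predictions X delta i w != None))%:R) =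
    \int[P]_w (\sum_i selected i w) - ETS P Y (predictions X delta).
  rewrite /ETS fine_expectation -RintegralB//; last 2 first.
  - by apply: integrable_sumR => i; exact: integrable_selected.
  - by apply: integrable_sumR => i; exact: integrable_correct.
  apply: eq_Rintegral => w _; rewrite -sumrB; apply: eq_bigr => i _.
  by rewrite /selected; do 2 case: (_ == _); rewrite ?subrr ?subr0.
have := ETS_ge0; rewrite /mFSR !fine_expectation numE.
set N := \int[P]_w (\sum_i selected i w); set E := ETS _ _ _.
have : 0 <= N by apply: Rintegral_ge0 => w _; rewrite sumr_ge0.
(* If the expected number of selections is 0, the quotient is 0 by convention and carries no
   information; the claim is then that ETS is nonnegative. *)
rewrite le_eqVlt => /predU1P[<- E0 _|N0 _].
  by rewrite mulr0.
by rewrite ler_pdivrMr// => ?; lra.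
Qed.

End rule.
End test_sample.

Lemma max_score_argmax (R : realType) (k : nat) (s : 'I_k.+1 -> R) (m : 'I_k.+1) :
  (forall j, s j <= s m) -> max_score s = s m.
Proof.
move=> sm; apply/le_anti/andP; split; first exact: bigmax_le.
exact: le_bigmax.
Qed.

(** * Scores, selections and gain of the oracle rule *)

Section oracle.
Context d (Omega : measurableType d) (R : realType) (P : probability Omega R)
        (n p k : nat) (X : 'I_n -> {RV P >-> feature R p})
        (Y : 'I_n -> {RV P >-> 'I_k.+1})
        (eta : 'I_n -> 'I_k.+1 -> {mfun feature R p >-> measurableTypeR R})
        (amax : 'I_n -> feature R p -> 'I_k.+1) (t : R).
Hypothesis etaP : forall i, is_cond_prob (X i) (Y i) (eta i).
Hypothesis amaxP : is_argmax (fun i j => eta i j) amax.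
Let S i w : R := max_score (fun j => eta i j (X i w) : R).
Let delta_OR := oracle_rule (fun i j => eta i j) amax t.

Lemma max_score_amax i x : max_score (fun j => eta i j x : R) = eta i (amax i x) x.
Proof.
rewrite (@max_score_argmax _ _ (fun j => eta i j x : R) (amax i x))// => j.
exact: (amaxP.2 i x j).
Qed.

Lemma score_le_max i j w : (eta i j (X i w) : R) <= S i w.
Proof. by rewrite /S max_score_amax; exact: (amaxP.2 i _ j). Qed.

Lemma integrable_max_score i : P.-integrable setT (EFin \o S i).
Proof.
(* The maximum is the score of the class [amax], that is, a finite sum of integrable scores cut off
   by measurable events. *)
have SE w : S i w = \sum_j (amax i (X i w) == j)%:R * (eta i j (X i w) : R).
  rewrite /S max_score_amax (bigD1 (amax i (X i w)))//= big1 ?addr0.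
    by rewrite eqxx mul1r.
  by move=> j; rewrite eq_sym => /negbTE ->; rewrite mul0r.
rewrite (funext SE); apply: integrable_sumR => j; apply: integrable_boolM.
  rewrite (_ : [set _ | _] = X i @^-1` (amax i @^-1` [set j])).
    apply: measurable_preimage; first exact: measurable_funP.
    by apply: measurable_preimage => //; exact: amaxP.1.
  by apply/seteqP; split => w /= /eqP.
exact: integrable_score.
Qed.

Lemma max_score_ge0 i : {ae P, forall w, 0 <= S i w}.
Proof.
apply: filterS (cond_prob_ge0 (etaP i) ord0) => w w0.
exact: le_trans w0 (score_le_max _ _ _).
Qed.

Lemma measurable_oracle i j : measurable (delta_OR i @^-1` [set Some j]).
Proof.
rewrite (_ : _ @^-1` _ = (fun x : features R p n => tnth x i) @^-1`
   ((eta i j @^-1` `]t, +oo[%classic) `&` (amax i @^-1` [set j]))).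
  apply: measurable_preimage; first exact: measurable_tnth.
  apply: measurableI; apply: measurable_preimage => //; last exact: amaxP.1.
apply/seteqP; split => x; rewrite /delta_OR /oracle_rule /= max_score_amax.
  by case: ifP => // tx [<-]; rewrite in_itv /= andbT.
by rewrite in_itv /= andbT => -[tx ->]; rewrite tx.
Qed.

Lemma oracleE i w : predictions X delta_OR i w =
  if t < S i w then Some (amax i (X i w)) else None.
Proof. by rewrite /predictions /delta_OR /oracle_rule tnth_mktuple. Qed.

Lemma selected_oracle i w : selected X delta_OR i w = (t < S i w)%R%:R.
Proof. by rewrite /selected oracleE; case: ifP. Qed.

Lemma gain_oracle i w : gain X eta delta_OR i w = (t < S i w)%R%:R * S i w.
Proof.
rewrite /gain oracleE; case: ifP => _; last first.
  by rewrite mul0r big1// => j _; rewrite mul0r.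
rewrite (bigD1 (amax i (X i w)))//= big1 ?addr0.
  by rewrite eqxx /S max_score_amax.
move=> j; rewrite (inj_eq (@Some_inj _)) eq_sym => /negbTE ->.
by rewrite mul0r.
Qed.

Lemma gain_le (delta : 'I_n -> features R p n -> option 'I_k.+1) i w :
  gain X eta delta i w <= selected X delta i w * S i w.
Proof.
rewrite /gain /selected; case: (predictions X delta i w) => [j|].
  rewrite (bigD1 j)//= big1 ?addr0 ?eqxx ?mul1r; first exact: score_le_max.
  by move=> j'; rewrite (inj_eq (@Some_inj _)) eq_sym => /negbTE ->; rewrite mul0r.
by rewrite mul0r big1// => j _; rewrite mul0r.
Qed.

Lemma measurable_max_score i : measurable_fun setT (S i).
Proof. exact/measurable_EFinP/(measurable_int P)/integrable_max_score. Qed.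

End oracle.

(** * Optimality of the oracle rule by a Lagrangian comparison *)

Theorem theorem6 (d : measure_display) (Omega : measurableType d)
    (R : realType) (P : probability Omega R) (n p k : nat)
    (X : 'I_n -> {RV P >-> feature R p})
    (Y : 'I_n -> {RV P >-> 'I_k.+1})
    (eta : 'I_n -> 'I_k.+1 -> {mfun feature R p >-> measurableTypeR R})
    (pi : 'I_k.+1 -> R) (F : 'I_k.+1 -> 'I_k.+1 -> R -> R)
    (amax : 'I_n -> feature R p -> 'I_k.+1)
    (alpha t : R) :
  let score i j w : R := eta i j (X i w) in
  let S i w : R := max_score (fun j => score i j w) in
  let delta_OR := oracle_rule (fun i j => eta i j) amax t in
  mutually_independent P (fun i w => (X i w, Y i w)) ->
  (forall i, is_cond_prob (X i) (Y i) (eta i)) ->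
  (forall i, mixture_model (score i) (Y i) pi F) ->
  is_argmax (fun i j => eta i j) amax ->
  is_Q_inverse P S alpha t ->
  (forall i, P [set w | S i w = t] = 0%E) ->
  forall delta : 'I_n -> features R p n -> option 'I_k.+1,
    in_D_alpha P X Y alpha delta ->
    ETS P Y (predictions X delta) <= ETS P Y (predictions X delta_OR).
Proof.
move=> score S delta_OR indep etaP _ amaxP [N0 QE] atom delta [mdelta mfsr].
have mS i : measurable_fun setT (S i) by exact: (measurable_max_score etaP amaxP).
have mD i j : measurable (delta i @^-1` [set Some j]).
  by apply: measurable_preimage.
have mO i j : measurable (delta_OR i @^-1` [set Some j]).
  exact: (measurable_oracle t amaxP).
have iG := integrable_gain etaP mD.
have iGO := integrable_gain etaP mO.
have is_ := integrable_selected X mD.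
have isO := integrable_selected X mO.
have GO i w : gain X eta delta_OR i w = (t < S i w)%R%:R * S i w.
  exact: (gain_oracle X t amaxP).
have sO i w : selected X delta_OR i w = (t < S i w)%R%:R.
  exact: selected_oracle.
have Gle i w : gain X eta delta i w <= selected X delta i w * S i w.
  exact: (gain_le X amaxP).
(* With no atom at [t], the weak inequality in [Q] and the strict one in the oracle rule agree
   almost surely, so [Q S t] is computed from the oracle's own selections. *)
have aet : {ae P, forall w, forall i, (t <= S i w) = (t < S i w)}.
  apply: filter_forall => i; exists [set w | S i w = t]; split => //.
    rewrite (_ : [set _ | _] = S i @^-1` [set t])//.
    exact: measurable_preimage.
  move=> w /= tS; apply: contrapT => /eqP St; apply: tS.
  by rewrite le_eqVlt eq_sym (negbTE St).
have mle i : measurable [set w | t <= S i w].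
  rewrite (_ : [set _ | _] = S i @^-1` `[t, +oo[%classic).
    exact: measurable_preimage.
  by apply/seteqP; split => w /=; rewrite in_itv /= andbT.
set NO := \int[P]_w (\sum_i selected X delta_OR i w).
have NOE : expected_selected P S t = NO.
  rewrite /expected_selected fine_expectation; apply: ae_eq_Rintegral.
  - by apply: measurable_sum => i; exact: measurable_indic_bool.
  - exact/measurable_EFinP/(measurable_int P)/integrable_sumR.
  - by apply: filterS aet => w wt; apply: eq_bigr => i _; rewrite sO wt.
set EO := \int[P]_w (\sum_i gain X eta delta_OR i w).
have iEO := integrable_sumR iGO.
have iNO := integrable_sumR isO.
have iED := integrable_sumR iG.
have iND := integrable_sumR is_.
have QnumE : fine 'E_P[fun w => \sum_(i < n) (1 - S i w) * (t <= S i w)%R%:R : R] =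
    NO - EO.
  rewrite fine_expectation /NO /EO -RintegralB//; apply: ae_eq_Rintegral.
  - apply: measurable_sum => i; apply: measurable_funM.
      exact: measurable_funB.
    exact: measurable_indic_bool.
  - by apply: measurable_funB; exact/measurable_EFinP/(measurable_int P).
  - apply: filterS aet => w wt; rewrite -sumrB; apply: eq_bigr => i _.
    by rewrite sO GO wt mulrBl mul1r [S i w * _]mulrC.
move: N0 QE; rewrite /Q QnumE NOE => N0 QE.
(* The mFSR constraint holds with equality for the oracle: [EO] equals [(1 - alpha) * NO]. *)
have {}QE : NO - EO = alpha * NO by rewrite -QE divfK// gt_eqF.
have := mFSR_le_ETS mD mfsr; rewrite !(ETS_gain indep etaP)// -/EO.
set ED := \int[P]_w (\sum_i gain X eta delta i w).
set ND := \int[P]_w (\sum_i selected X delta i w) => EDge.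
have [t0|t0] := ltP t 0.
  (* Scores can be negative on a null set. Passing to positive parts leaves [EO] unchanged and makes
     the comparison of the summands valid at every point. *)
  have -> : EO = \int[P]_w (\sum_i Num.max (gain X eta delta_OR i w) 0).
    apply: ae_eq_Rintegral.
    - exact/measurable_EFinP/(measurable_int P).
    - apply: measurable_sum => i; apply: measurable_maxr => //.
      exact/measurable_EFinP/(measurable_int P).
    - have : {ae P, forall w, forall i, 0 <= S i w}.
        by apply: filter_forall => i; exact: (max_score_ge0 etaP amaxP).
      apply: filterS => w w0; apply: eq_bigr => i _.
      by rewrite max_l// GO mulr_ge0.
  apply: le_Rintegral => //.
    apply: integrable_sumR => i.
    exact: (integrable_funrpos measurableT (iGO i)).
  move=> w _; apply: ler_sum => i _; apply: le_trans (Gle i w) _.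
  rewrite GO /selected; case: ltP => [tS|St]; last first.
    rewrite mul0r maxxx; apply: mulr_ge0_le0 => //.
    exact: le_trans St (ltW t0).
  by rewrite mul1r; case: (_ != _); rewrite ?mul1r ?mul0r le_max lexx ?orbT.
have lagrangian (A B : 'I_n -> Omega -> R) :
    (forall i, P.-integrable setT (EFin \o A i)) ->
    (forall i, P.-integrable setT (EFin \o B i)) ->
    P.-integrable setT (EFin \o (fun w => \sum_i (A i w - t * B i w))) /\
    \int[P]_w (\sum_i (A i w - t * B i w)) =
    \int[P]_w (\sum_i A i w) - t * \int[P]_w (\sum_i B i w).
  move=> iA iB.
  have iAB i : P.-integrable setT (EFin \o (fun w => A i w - t * B i w)).
    rewrite (_ : _ \o _ = (EFin \o A i \- (fun w => t%:E * (EFin \o B i) w))%E)//.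
    by apply: integrableB => //; exact: integrableZl.
  have iB' i : P.-integrable setT (EFin \o (fun w => t * B i w)).
    rewrite (_ : _ \o _ = (fun w => t%:E * (EFin \o B i) w)%E)//.
    exact: integrableZl.
  split; first exact: integrable_sumR.
  rewrite !Rintegral_sum// mulr_sumr -sumrB; apply: eq_bigr => i _.
  by rewrite RintegralB// RintegralZl.
have [iLD LD] := lagrangian _ _ iG is_.
have [iLO LO] := lagrangian _ _ iGO isO.
have LOge0 i w : 0 <= gain X eta delta_OR i w - t * selected X delta_OR i w.
  rewrite GO sO mulrC -mulrBl; case: ltP => tS; rewrite ?mulr1 ?mulr0//.
  by rewrite subr_ge0 ltW.
(* Selecting exactly when [S i w - t] is positive maximizes the selection indicator times
   [S i w - t] at each point. *)
have Lle : ED - t * ND <= EO - t * NO.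
  rewrite -LD -LO; apply: le_Rintegral => // w _; apply: ler_sum => i _.
  apply: (@le_trans _ _ (selected X delta i w * (S i w - t))).
    by rewrite mulrBr [selected _ _ _ _ * t]mulrC lerB.
  rewrite {1}/selected; case: (_ != _); rewrite ?mul0r// mul1r GO sO.
  by case: ltP => tS; rewrite ?mul1r ?mulr1// mul0r mulr0 subr0 subr_le0.
(* Were this integral 0, its nonnegative integrand would vanish almost surely. Each selected sample
   contributes the positive amount [S i w - t], so almost surely nothing would be selected, against
   [N0]. *)
have Lgt0 : 0 < EO - t * NO.
  rewrite lt_neqAle -LO Rintegral_ge0 ?andbT; last first.
    by move=> w _; apply: sumr_ge0.
  apply/eqP => /esym I0.
  have L0 : {ae P, forall w, \sum_i selected X delta_OR i w = 0}.
    have := Rintegral_eq0_ae iLO _ I0.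
    move=> /(_ (fun w => sumr_ge0 _ (fun i _ => LOge0 i w))).
    apply: filterS => w /eqP; rewrite psumr_eq0// => /allP Lw; apply: big1 => i _.
    have := Lw i (mem_index_enum i); rewrite GO sO.
    case: ltP => // tS; rewrite mul1r mulr1 subr_eq0 => /eqP St.
    by rewrite St ltxx in tS.
  move: N0; rewrite /NO (@ae_eq_Rintegral _ _ _ _ _ (cst 0))//.
    by rewrite Rintegral_cst// mul0r ltxx.
  exact/measurable_EFinP/(measurable_int P).
(* By the equality for the oracle, [EO - t * NO] is [(1 - alpha - t) * NO]. *)
have c0 : 0 < 1 - alpha - t.
  by rewrite -(pmulr_lgt0 _ N0); lra.
have a0 : 0 <= 1 - alpha by lra.
(* Multiply [Lle] by [1 - alpha], bound [(1 - alpha) * ND] by [ED], and replace [(1 - alpha) * NO]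
   by [EO]: both sides become [1 - alpha - t] times an ETS. [H2] and [H3] supply the products with
   [t] that linear arithmetic cannot form. *)
rewrite -(ler_pM2l c0).
have H1 := ler_wpM2l a0 Lle.
have H2 : 0 <= t * (ED - (1 - alpha) * ND) by rewrite mulr_ge0 ?subr_ge0.
have H3 : t * EO = t * ((1 - alpha) * NO) by congr (t * _); lra.
lra.
Qed.
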